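(* Let $\mathcal{A}$ be an algebra and $\mathcal{B}$ be a subalgebra of $\mathcal{A}$. Then $\mathcal{A}$ and $\mathcal{B}$ are both faithful if and only if the direct-sum product algebra $\mathcal{A} \times_d \mathcal{B}$ is faithful.
   Context: Algebras are associative algebras over $\mathbb{C}$ (not assumed unital or commutative). An algebra $\mathcal{A}$ is faithful if the only $a \in \mathcal{A}$ with $ab = 0$ for all $b \in \mathcal{A}$ is $a = 0$. For an algebra $\mathcal{A}$ and a subalgebra $\mathcal{B}$ of $\mathcal{A}$, the direct-sum product algebra $\mathcal{A} \times_d \mathcal{B}$ is the vector space $\mathcal{A} \times \mathcal{B}$ with coordinatewise linear operations and the product $(a,b) \times_d (c,d) = (ac + ad + bc, bd)$. *)

(* Defs.v *)
From HB Require Import structures.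
From mathcomp Require Import all_boot all_algebra.
From mathcomp Require Import complex.
From mathcomp Require Import reals.

Set Implicit Arguments.
Unset Strict Implicit.
Unset Printing Implicit Defensive.

Import GRing.Theory.
Local Open Scope ring_scope.

(* The library's algType is unital, so associative algebras that need not have
   a unit are introduced here as modules with an associative bilinear product. *)

Reserved Notation "x ** y" (at level 40, left associativity).

HB.mixin Record Lmodule_isNUAlgebra (K : comPzRingType) A
    of GRing.Lmodule K A := {
  numul : A -> A -> A;
  numulA : associative numul;
  numulDl : left_distributive numul +%R;
  numulDr : right_distributive numul +%R;
  numulZl : forall (k : K) (x y : A), numul (k *: x) y = k *: numul x y;
  numulZr : forall (k : K) (x y : A), numul x (k *: y) = k *: numul x y
}.

#[short(type="nuAlgType")]
HB.structure Definition NUAlgebra (K : comPzRingType) :=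
  {A of Lmodule_isNUAlgebra K A & GRing.Lmodule K A}.

Notation "x ** y" := (numul x y) : ring_scope.

Definition faithful (K : comPzRingType) (A : nuAlgType K) : Prop :=
  forall a : A, (forall b : A, a ** b = 0) -> a = 0.

HB.mixin Record isNUMulClosed (K : comPzRingType) (A : nuAlgType K)
    (S : {pred A}) := {
  numul_closed : {in S &, forall x y, x ** y \in S}
}.

#[short(type="nuSubalgClosed")]
HB.structure Definition NUSubalgClosed (K : comPzRingType) (A : nuAlgType K) :=
  {S of isNUMulClosed K A S & @GRing.SubmodClosed K A S}.

Section Subalgebra.
Variables (K : comPzRingType) (A : nuAlgType K) (B : nuSubalgClosed A).

Record subalg_of := SubalgOf { subalg_val : A; _ : subalg_val \in B }.

HB.instance Definition _ := [isSub for subalg_val].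
HB.instance Definition _ := [Choice of subalg_of by <:].
HB.instance Definition _ := [SubChoice_isSubLmodule of subalg_of by <:].

Definition subalg_mul (x y : subalg_of) : subalg_of :=
  SubalgOf (numul_closed _ _ (valP x) (valP y)).

Fact subalg_mulA : associative subalg_mul.
Proof. by move=> x y z; apply/val_inj/numulA. Qed.

Fact subalg_mulDl : left_distributive subalg_mul +%R.
Proof. by move=> x y z; apply/val_inj/numulDl. Qed.

Fact subalg_mulDr : right_distributive subalg_mul +%R.
Proof. by move=> x y z; apply/val_inj/numulDr. Qed.

Fact subalg_mulZl (k : K) x y : subalg_mul (k *: x) y = k *: subalg_mul x y.
Proof. exact/val_inj/numulZl. Qed.

Fact subalg_mulZr (k : K) x y : subalg_mul x (k *: y) = k *: subalg_mul x y.
Proof. exact/val_inj/numulZr. Qed.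

HB.instance Definition _ := Lmodule_isNUAlgebra.Build K subalg_of
  subalg_mulA subalg_mulDl subalg_mulDr subalg_mulZl subalg_mulZr.

End Subalgebra.

Section DirectSumProduct.
Variables (K : comPzRingType) (A : nuAlgType K) (B : nuSubalgClosed A).

(* An alias of the product type: it keeps the coordinatewise module structure
   but carries a product that is not coordinatewise. *)
Definition dsprod : Type := (A * subalg_of B)%type.

HB.instance Definition _ :=
  GRing.Lmodule.copy dsprod (A * subalg_of B)%type.

Definition dsprod_mul (u v : dsprod) : dsprod :=
  (u.1 ** v.1 + u.1 ** val v.2 + val u.2 ** v.1, u.2 ** v.2).

Fact dsprod_mulA : associative dsprod_mul.
Proof.
move=> [a b] [c d] [e f]; congr pair; last exact: numulA.
rewrite /= !numulDl !numulDr !numulA -!addrA; congr (_ + _).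
rewrite [LHS]addrCA; congr (_ + _).
rewrite [RHS]addrCA; congr (_ + _).
exact: addrCA.
Qed.

Fact dsprod_mulDl : left_distributive dsprod_mul +%R.
Proof.
move=> [a b] [c d] [e f]; congr pair; last exact: numulDl.
by rewrite /= !numulDl [X in X + _]addrACA [LHS]addrACA.
Qed.

Fact dsprod_mulDr : right_distributive dsprod_mul +%R.
Proof.
move=> [a b] [c d] [e f]; congr pair; last exact: numulDr.
by rewrite /= !numulDr [X in X + _]addrACA [LHS]addrACA.
Qed.

Fact dsprod_mulZl (k : K) u v : dsprod_mul (k *: u) v = k *: dsprod_mul u v.
Proof.
case: u v => [a b] [c d]; congr pair; last exact: numulZl.
by rewrite /= !numulZl !scalerDr.
Qed.

Fact dsprod_mulZr (k : K) u v : dsprod_mul u (k *: v) = k *: dsprod_mul u v.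
Proof.
case: u v => [a b] [c d]; congr pair; last exact: numulZr.
by rewrite /= !numulZr !scalerDr.
Qed.

HB.instance Definition _ := Lmodule_isNUAlgebra.Build K dsprod
  dsprod_mulA dsprod_mulDl dsprod_mulDr dsprod_mulZl dsprod_mulZr.

End DirectSumProduct.

(* Main.v *)
(** If [(a, b)] annihilates the product algebra on the left then [b] annihilates
    [B], so [b = 0], and then [a] annihilates [A].  Conversely [(a, 0)] lifts a
    left annihilator [a] of [A], and [(- b, b)] lifts a left annihilator [b] of
    [B], since [(- b, b) (c, d) = (- b d, b d)]. *)
Require Import Defs.
From mathcomp Require Import all_boot all_algebra.
From mathcomp Require Import complex reals.

Import GRing.Theory.
Local Open Scope ring_scope.
Local Open Scope complex_scope.

(** Write [0] as [0 *: 0] and pull the scalar out of the product. *)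
Lemma numul0 (K : comPzRingType) (A : nuAlgType K) (x : A) : x ** 0 = 0.
Proof. by rewrite -(scale0r 0) numulZr !scale0r. Qed.

Lemma nu0mul (K : comPzRingType) (A : nuAlgType K) (x : A) : 0 ** x = 0.
Proof. by rewrite -(scale0r 0) numulZl !scale0r. Qed.

Lemma nuNmul (K : comPzRingType) (A : nuAlgType K) (x y : A) :
  (- x) ** y = - (x ** y).
Proof. by rewrite -scaleN1r numulZl scaleN1r. Qed.

Lemma faithful_dsprod (K : comPzRingType) (A : nuAlgType K)
    (B : nuSubalgClosed A) :
  faithful A /\ faithful (subalg_of B) <-> faithful (dsprod B).
Proof.
split=> [[fA fB] [a b] ab0 | fAB].
  have b0 : b = 0 by apply: fB => d; exact: (congr1 snd (ab0 (0, d))).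
  have a0 : a = 0.
    (* Testing against [(c, 0)] removes the term in [a ** val d], and [b = 0] removes [val b ** c];
       only [a ** c] is left. *)
    apply: fA => c; move: (congr1 fst (ab0 (c, 0))) => /=.
    by rewrite b0 numul0 nu0mul !addr0.
  by rewrite a0 b0.
split=> [a a0 | b b0].
  suff [] : (a, 0) = 0 :> dsprod B by [].
  apply: fAB => -[c d]; congr pair; last exact: nu0mul.
  (* [a0] covers [a ** val d] as well, since [val d] lies in [A]. *)
  by rewrite /= !a0 nu0mul !addr0.
suff [] : (- val b, b) = 0 :> dsprod B by [].
apply: fAB => -[c d]; congr pair; last exact: b0.
have /(congr1 val) /= bd0 := b0 d.
(* Nothing is known of [val b ** c] for [c] outside [B]; it cancels against its opposite. *)
by rewrite /= !nuNmul bd0 oppr0 addr0 addNr.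
Qed.

Theorem lemma2p4 (R : realType) (A : nuAlgType R[i]) (B : nuSubalgClosed A) :
  faithful A /\ faithful (subalg_of B) <-> faithful (dsprod B).
Proof. exact: faithful_dsprod. Qed.
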